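(* Let $A$ be a $2\times 2$ complex matrix. Then its numerical range \[\mathrm W(A)=\{\langle A\mathbf x,\mathbf x\rangle \,:\, \mathbf x\in\mathbb C^2,\ |\mathbf x|=1\}\] is a possibly degenerate elliptical disk in the complex plane, whose foci are the eigenvalues of $A$ (counted with multiplicity), and whose major and minor semi-axes are $s^{+}(A)$ and $s^{-}(A)$, respectively, where \[s^{\pm}(A)=\frac12\sqrt{\operatorname{tr}\left(\left(A-\frac{\operatorname{tr}A}{2}\operatorname{Id}\right)^*\left(A-\frac{\operatorname{tr}A}{2}\operatorname{Id}\right)\right)\pm\left|\operatorname{tr}\left(\left(A-\frac{\operatorname{tr}A}{2}\operatorname{Id}\right)^2\right)\right|}.\]
   Context: Here $\langle\mathbf x,\mathbf y\rangle=x_1\overline{y_1}+x_2\overline{y_2}$ is the standard Hermitian inner product on $\mathbb C^2$, $|\mathbf x|=\sqrt{\langle \mathbf x,\mathbf x\rangle}$, $A^*$ is the conjugate transpose of $A$, and $\operatorname{Id}$ is the $2\times2$ identity matrix. The complex plane is identified with $\mathbb R^2$ in the usual way. A possibly degenerate elliptical disk with major semi-axis $s^+$ and minor semi-axis $s^-$ (lengths, $s^+\ge s^-\ge 0$) is a subset of the plane which is the image under an orientation-preserving isometry of the plane of the filled (closed) set $\{(s^+u,\,s^-v): u,v\in\mathbb R,\ u^2+v^2\le 1\}$; its foci are the images of the points $(\pm\sqrt{(s^+)^2-(s^-)^2},\,0)$. Degenerate cases are allowed: if $s^-=0<s^+$ the disk is a closed line segment with the foci as endpoints; if $s^+=s^-=0$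 it is a single point; if $s^+=s^-$ it is a circular disk (possibly a point) and the two foci coincide with its center. Equivalently, the disk with foci $f_1,f_2\in\mathbb C$ and semi-axes $s^+\ge s^-\ge0$ is the set $\{w\in\mathbb C: |w-f_1|+|w-f_2|\le 2s^+\}$, where $(s^+)^2-(s^-)^2=|f_1-f_2|^2/4$. *)

(* Defs.v *)
From HB Require Import structures.
From mathcomp Require Import all_boot all_order all_algebra.
From mathcomp Require Import complex.
From mathcomp Require Import classical_sets reals.

Set Implicit Arguments.
Unset Strict Implicit.
Unset Printing Implicit Defensive.

Import Order.TTheory GRing.Theory Num.Theory.
Local Open Scope ring_scope.
Local Open Scope sesquilinear_scope.
Local Open Scope classical_set_scope.
Local Open Scope complex_scope.

Section Plane.
Variable R : realType.
Implicit Types (phi : R[i] -> R[i]) (z : R[i]).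

Definition isometry phi := forall z w, `|phi z - phi w| = `|z - w|.

(* Twice the signed area of the triangle z0 z1 z2. *)
Definition signed_area z0 z1 z2 : R := complex.Im ((z1 - z0)^* * (z2 - z0)).

Definition orientation_preserving phi :=
  forall z0 z1 z2, 0 < signed_area z0 z1 z2 ->
    0 < signed_area (phi z0) (phi z1) (phi z2).

Definition standard_elliptical_disk (sp sm : R) : set R[i] :=
  [set z | exists u v : R,
     u ^+ 2 + v ^+ 2 <= 1 /\ z = (sp * u) +i* (sm * v)].

(* E is a possibly degenerate elliptical disk with major semi-axis sp and
   minor semi-axis sm, and foci is the list, in any order, of its two foci,
   which are listed twice when they coincide. *)
Definition is_elliptical_disk (E : set R[i]) (foci : seq R[i]) (sp sm : R) :=
  0 <= sm <= sp /\
  exists phi, [/\ isometry phi, orientation_preserving phi,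
    E = phi @` standard_elliptical_disk sp sm &
    let c := (Num.sqrt (sp ^+ 2 - sm ^+ 2))%:C in
    perm_eq foci [:: phi c; phi (- c)]].

End Plane.

Section Matrices.
Variable R : realType.

Definition hdot n (x y : 'cV[R[i]]_n) : R[i] := \sum_(i < n) x i 0 * (y i 0)^*.

Definition hnorm n (x : 'cV[R[i]]_n) : R[i] := sqrtC (hdot x x).

Definition numerical_range n (A : 'M[R[i]]_n) : set R[i] :=
  [set hdot (A *m x) x | x in [set x : 'cV[R[i]]_n | hnorm x = 1]].

(* The roots of the characteristic polynomial, repeated according to their
   algebraic multiplicity. *)
Definition eigenvalues n (A : 'M[R[i]]_n) : seq R[i] :=
  sval (closed_field_poly_normal (char_poly A)).

Lemma char_poly_eigenvalues n (A : 'M[R[i]]_n) :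
  char_poly A = \prod_(z <- eigenvalues A) ('X - z%:P).
Proof.
rewrite /eigenvalues; case: closed_field_poly_normal => s /= {1}->.
by rewrite (monicP (char_poly_monic A)) scale1r.
Qed.

Definition traceless_part (A : 'M[R[i]]_2) : 'M[R[i]]_2 :=
  A - (\tr A / 2)%:M.

(* The radicand is a real element of R[i] (lemmas below); Re reads it in R. *)
Definition radicand_plus (A : 'M[R[i]]_2) : R[i] :=
  let B := traceless_part A in \tr (B ^t* *m B) + `|\tr (B *m B)|.

Definition radicand_minus (A : 'M[R[i]]_2) : R[i] :=
  let B := traceless_part A in \tr (B ^t* *m B) - `|\tr (B *m B)|.

Definition semiaxis_plus (A : 'M[R[i]]_2) : R :=
  2^-1 * Num.sqrt (complex.Re (radicand_plus A)).

Definition semiaxis_minus (A : 'M[R[i]]_2) : R :=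
  2^-1 * Num.sqrt (complex.Re (radicand_minus A)).

Lemma trace_adjmul_ge0 n (B : 'M[R[i]]_n) : 0 <= \tr (B ^t* *m B).
Proof.
rewrite /mxtrace; apply: sumr_ge0 => i _; rewrite mxE.
by apply: sumr_ge0 => j _; rewrite !mxE mulrC mul_conjC_ge0.
Qed.

Lemma radicand_plus_real A : radicand_plus A \is Num.real.
Proof. by rewrite realD ?normr_real// ger0_real ?trace_adjmul_ge0. Qed.

Lemma radicand_minus_real A : radicand_minus A \is Num.real.
Proof. by rewrite realB ?normr_real// ger0_real ?trace_adjmul_ge0. Qed.

End Matrices.

(* Main.v *)
(* Expand the traceless part of A in Pauli matrices, with coefficient vector w
   in C^3.  If the unit vector x represents the point n of the Bloch sphere,
   then <Ax, x> = tr A / 2 + w.n.  Choose a phase p for which the real and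
   imaginary parts h and k of w / p satisfy (h + i k).(h + i k) >= 0, that is,
   h is orthogonal to k and |k| <= |h|.  Up to the isometry
   z |-> tr A / 2 + p z, the numerical range is then the set of points
   (h.n, k.n) with |n| = 1.  As h and k are orthogonal, it is the image of an
   orthogonal projection of the unit sphere, i.e. of the unit disk, under the
   scalings by |h| and |k|.  The axes and foci follow from
   tr B^2 = 2 p^2 (|h|^2 - |k|^2) and tr (B^* B) = 2 (|h|^2 + |k|^2), where B
   is the traceless part of A. *)
Require Import Defs.
From HB Require Import structures.
From mathcomp Require Import all_boot all_order all_algebra.
From mathcomp Require Import complex.
From mathcomp Require Import classical_sets reals.
From mathcomp Require Import ring lra.

Import Order.TTheory GRing.Theory Num.Theory.
Local Open Scope ring_scope.

(** * Orthonormal pairs in Euclidean 3-space and projections of the unit sphere *)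

Section EuclideanSpace.
Variable R : rcfType.
Implicit Types (t u v : R) (a b e f h k n : R * R * R).

Definition dot a b : R := a.1.1 * b.1.1 + a.1.2 * b.1.2 + a.2 * b.2.

Definition cross a b : R * R * R :=
  (a.1.2 * b.2 - a.2 * b.1.2, a.2 * b.1.1 - a.1.1 * b.2,
   a.1.1 * b.1.2 - a.1.2 * b.1.1).

Definition scale t a : R * R * R := (t * a.1.1, t * a.1.2, t * a.2).

Definition len a : R := Num.sqrt (dot a a).

Definition orthonormal e f := [/\ dot e e = 1, dot f f = 1 & dot e f = 0].

Lemma dot_scalel t a b : dot (scale t a) b = t * dot a b.
Proof. rewrite /dot /=; ring. Qed.

Lemma dot_ge0 a : 0 <= dot a a.
Proof. by rewrite /dot -!expr2 !addr_ge0 ?sqr_ge0. Qed.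

Lemma dot_eq0 a : dot a a = 0 -> a = (0, 0, 0).
Proof.
case: a => [[x y] z]; rewrite /dot /= -!expr2 => /eqP.
rewrite !paddr_eq0 ?addr_ge0 ?sqr_ge0// !sqrf_eq0.
by move=> /andP[/andP[/eqP-> /eqP->] /eqP->].
Qed.

Lemma len_sqr a : len a ^+ 2 = dot a a.
Proof. by rewrite sqr_sqrtr ?dot_ge0. Qed.

Lemma normalize a : dot a a <> 0 ->
  exists e, dot e e = 1 /\ a = scale (len a) e.
Proof.
move=> /eqP a0; have l0 : len a != 0 by rewrite -sqrf_eq0 len_sqr.
exists (scale (len a)^-1 a); split.
  have -> : dot (scale (len a)^-1 a) (scale (len a)^-1 a)
    = (len a)^-1 ^+ 2 * dot a a by rewrite /dot /=; ring.
  by rewrite -len_sqr -exprMn mulVf ?expr1n.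
by case: a l0 {a0} => [[x y] z] l0; rewrite /scale /= !mulVKf.
Qed.

(** Turning the horizontal part of [e] by a right angle gives a perpendicular vector to normalize;
    if that part is zero, [e] is vertical and the first basis vector serves. *)
Lemma exists_perp e : dot e e = 1 -> exists f, orthonormal e f.
Proof.
case: e => [[x y] z] ee.
have [/eqP xy0|xy0] := boolP (dot (- y, x, 0) (- y, x, 0) == 0).
  exists (1, 0, 0); split => //; first by rewrite /dot /=; ring.
  by case/dot_eq0: xy0 => _ ->; rewrite /dot /=; ring.
have [f [ff yx]] := normalize _ (elimN eqP xy0); exists f; split => //.
have : dot (- y, x, 0) (x, y, z) = 0 by rewrite /dot /=; ring.
rewrite {1}yx dot_scalel => /eqP; rewrite mulf_eq0 => /orP[/eqP l0|/eqP <-].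
  by rewrite -len_sqr l0 expr0n eqxx in xy0.
by rewrite /dot /=; ring.
Qed.

(** A zero vector has no direction of its own, so its axis is free. Since [k] is the shorter vector,
    [h = 0] forces [k = 0], which leaves three cases. *)
Lemma exists_orthonormal_axes h k : dot h k = 0 -> dot k k <= dot h h ->
  exists e f, [/\ orthonormal e f, h = scale (len h) e & k = scale (len k) f].
Proof.
have scale0 a e : dot a a = 0 -> a = scale (len a) e.
  move=> aa; rewrite /len aa sqrtr0 {1}(dot_eq0 _ aa).
  by rewrite /scale !mul0r.
move=> hk kh; have [/eqP k0|/eqP k0] := boolP (dot k k == 0).
  have [/eqP h0|/eqP h0] := boolP (dot h h == 0).
    exists (1, 0, 0), (0, 1, 0); split; [|exact: scale0|exact: scale0].
    by split; rewrite /dot /=; ring.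
  have [e [ee he]] := normalize _ h0; have [f ef] := exists_perp _ ee.
  by exists e, f; split => //; exact: scale0.
have h0 : dot h h <> 0.
  by move=> h0; apply: k0; apply/le_anti; rewrite dot_ge0 -h0 kh.
have [[e [ee he]] [f [ff kf]]] := (normalize _ h0, normalize _ k0).
exists e, f; split => //; split => //.
have : dot h k = len h * len k * dot e f.
  by rewrite {1}he {1}kf /dot /=; ring.
move/eqP; rewrite hk eq_sym !mulf_eq0 => /orP[/orP[]|/eqP//] /eqP l0.
  by case: h0; rewrite -len_sqr l0 expr0n.
by case: k0; rewrite -len_sqr l0 expr0n.
Qed.

(** The squared triple product of [e], [f], [n] is their Gram determinant; for orthonormal [e], [f]
    this becomes Parseval's identity in the basis completed by [cross e f]. *)
Lemma gram e f n : orthonormal e f ->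
  dot n n = dot e n ^+ 2 + dot f n ^+ 2 + dot (cross e f) n ^+ 2.
Proof.
case=> ee ff ef; have -> : dot (cross e f) n ^+ 2 =
    dot e e * dot f f * dot n n + 2 * dot e f * dot e n * dot f n
    - dot e e * dot f n ^+ 2 - dot f f * dot e n ^+ 2 - dot n n * dot e f ^+ 2.
  by rewrite /dot /=; ring.
by rewrite ee ff ef; ring.
Qed.

Lemma sphere_projection e f u v : orthonormal e f ->
  (exists n, [/\ dot n n = 1, dot e n = u & dot f n = v]) <->
  u ^+ 2 + v ^+ 2 <= 1.
Proof.
move=> ef; split=> [[n [nn <- <-]]|uv].
  by rewrite -nn (gram e f) // lerDl sqr_ge0.
(* [w] is the height along [cross e f] that lifts [(u, v)] to the unit sphere. *)
pose w := Num.sqrt (1 - (u ^+ 2 + v ^+ 2)); pose g := cross e f.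
exists (u * e.1.1 + v * f.1.1 + w * g.1.1, u * e.1.2 + v * f.1.2 + w * g.1.2,
        u * e.2 + v * f.2 + w * g.2).
set n := (X in dot X X).
case: (ef) => ee ff e0.
have en : dot e n = u * dot e e + v * dot e f by rewrite /dot /=; ring.
have fn : dot f n = u * dot e f + v * dot f f by rewrite /dot /=; ring.
have gn : dot g n = w * (dot e e * dot f f - dot e f ^+ 2).
  by rewrite /dot /=; ring.
rewrite (gram e f) // -/g gn en fn ee ff e0 !mulr0 !mulr1 addr0 add0r.
by split=> //; rewrite expr0n subr0 mulr1 sqr_sqrtr ?subr_ge0// addrC subrK.
Qed.

End EuclideanSpace.

Arguments dot {R}.
Arguments scale {R}.
Arguments len {R}.
Arguments orthonormal {R}.

(** * Determinant and eigenvalues of a 2 by 2 matrix *)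

Lemma det_mx22 (K : comNzRingType) (M : 'M[K]_2) :
  \det M = M 0 0 * M 1 1 - M 0 1 * M 1 0.
Proof.
rewrite (expand_det_row _ 0) !big_ord_recl big_ord0 /cofactor !det_mx11 !mxE /=.
rewrite !(addr0, expr0, mul1r, expr1, addn0, add0n) mulN1r mulrN.
by congr (_ * M _ _ - M _ _ * M _ _); exact: val_inj.
Qed.

Lemma eigenvalues_mx22 (R : realType) (A : 'M[R[i]]_2) (m l : R[i]) :
  \tr A = m + m -> \det A = m ^+ 2 - l ^+ 2 ->
  perm_eq (eigenvalues A) [:: m + l; m - l].
Proof.
move=> trA detA; apply: prod_XsubC_eq; rewrite -char_poly_eigenvalues.
rewrite !big_cons big_nil mulr1.
have -> : char_poly A = 'X^2 - (\tr A)%:P * 'X + (\det A)%:P.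
  rewrite /char_poly det_mx22 det_mx22 /mxtrace !big_ord_recl big_ord0 !mxE /=.
  have -> : lift 0 0 = 1 :> 'I_2 by exact: val_inj.
  by rewrite /= ?(mulr0n, mulr1n); ring.
by rewrite trA detA; ring.
Qed.

(** * Pauli coordinates and the Bloch sphere *)

Section Pauli.
Variable R : realType.
Implicit Types (h k n : R * R * R) (A : 'M[R[i]]_2) (x : 'cV[R[i]]_2).
Local Open Scope complex_scope.

(* The traceless matrix [\sum_j (h_j + i k_j) sigma_j], with [sigma_j] the
   Pauli matrices. *)
Definition pauli h k : 'M[R[i]]_2 :=
  let a := h.1.1 +i* k.1.1 in let b := h.1.2 +i* k.1.2 in
  let c := h.2 +i* k.2 in
  \matrix_(i, j) if i == 0 then if j == 0 then c else a - 'i * b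
                 else if j == 0 then a + 'i * b else - c.

(* The point of the Bloch sphere represented by the unit vector [x]. *)
Definition bloch x : R * R * R :=
  let q := 2 * (x 1 0 * (x 0 0)^*)%R in
  (complex.Re q, complex.Im q,
   complex.Re (x 0 0 * (x 0 0)^* - x 1 0 * (x 1 0)^*)%R).

Lemma ord2_lift : lift 0 0 = 1 :> 'I_2.
Proof. exact: val_inj. Qed.

Lemma mxtrace22 A : \tr A = A 0 0 + A 1 1.
Proof. by rewrite /mxtrace !big_ord_recl big_ord0 addr0 ord2_lift. Qed.

Lemma mulmx22 q A (B : 'M[R[i]]_(2, q)) i j :
  (A *m B) i j = A i 0 * B 0 j + A i 1 * B 1 j.
Proof. by rewrite mxE !big_ord_recl big_ord0 addr0 ord2_lift. Qed.

Lemma hdot2 x y : hdot x y = (x 0 0 * (y 0 0)^* + x 1 0 * (y 1 0)^*)%R.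
Proof. by rewrite /hdot !big_ord_recl big_ord0 addr0 ord2_lift. Qed.

Lemma trace_pauli h k : \tr (pauli h k) = 0.
Proof. by rewrite mxtrace22 !mxE /= subrr. Qed.

Lemma trace_pauli_sqr h k : \tr (pauli h k *m pauli h k) =
  2 * ((dot h h - dot k k) +i* (2 * dot h k)).
Proof.
rewrite mxtrace22 !mulmx22 !mxE /= /dot /=; apply/eqP.
rewrite eq_complex /=; apply/andP; split; apply/eqP; ring.
Qed.

Lemma trace_pauli_adj h k : \tr (((pauli h k)^t*)%sesqui *m pauli h k) =
  (2 * (dot h h + dot k k))%:C.
Proof.
rewrite mxtrace22 !mulmx22 !mxE /= /dot /=; apply/eqP.
rewrite eq_complex /=; apply/andP; split; apply/eqP; ring.
Qed.

Lemma det_pauli h k :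
  \det (pauli h k) = (dot k k - dot h h) +i* (- (2 * dot h k)).
Proof.
rewrite det_mx22 !mxE /= /dot /=; apply/eqP.
rewrite eq_complex /=; apply/andP; split; apply/eqP; ring.
Qed.

(** The j-th coordinate of [bloch x] is the quadratic form of [sigma_j] at [x]; the rest is
    linearity. *)
Lemma hdot_pauli h k x :
  hdot (pauli h k *m x) x = dot h (bloch x) +i* dot k (bloch x).
Proof.
rewrite hdot2 !mulmx22 !mxE /= /dot /bloch.
case: (x 0 0) (x 1 0) => [x1 y1] [x2 y2] /=; apply/eqP.
rewrite eq_complex /=; apply/andP; split; apply/eqP; ring.
Qed.

(** The norm identity of the Hopf map: it places [bloch x] on the unit sphere when [x] is a unit
    vector. *)
Lemma dot_bloch x : (dot (bloch x) (bloch x))%:C = hdot x x ^+ 2.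
Proof.
rewrite hdot2 /dot /bloch.
case: (x 0 0) (x 1 0) => [x1 y1] [x2 y2] /=; apply/eqP.
rewrite eq_complex /=; apply/andP; split; apply/eqP; ring.
Qed.

Lemma bloch_surj n : dot n n = 1 -> exists x, hdot x x = 1 /\ bloch x = n.
Proof.
case: n => [[a b] c]; rewrite /dot /= => abc.
(* The south pole is represented by the second basis vector. Elsewhere the phase of [x] is fixed by
   making its first entry a positive real [r]: the third coordinate [2 r^2 - 1 = c] determines [r],
   and the other two determine the second entry. *)
have [/eqP c1|c1] := boolP (c == -1).
  have : dot (a, b, 0) (a, b, 0) = 0 by rewrite /dot /=; nra.
  case/dot_eq0 => -> ->; exists (\col_i (i == 1)%:R); split.
    by rewrite hdot2 !mxE /= rmorph1 rmorph0; ring.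
  rewrite /bloch !mxE /= c1; congr (_, _, _) => /=; ring.
have c_gt : 0 < 1 + c.
  rewrite lt_neqAle eq_sym addrC addr_eq0 c1 /=; nra.
pose r := Num.sqrt ((1 + c) / 2).
have r2 : r ^+ 2 = (1 + c) / 2 by rewrite sqr_sqrtr// divr_ge0 // ltW.
have r0 : r != 0 by rewrite -sqrf_eq0 r2; apply/eqP; lra.
have ab2 : (a / (2 * r)) ^+ 2 + (b / (2 * r)) ^+ 2 = 1 - r ^+ 2.
  have ab : a ^+ 2 + b ^+ 2 = 4 * r ^+ 2 * (1 - r ^+ 2).
    by rewrite r2; nra.
  by rewrite !expr_div_n -mulrDl ab; field.
pose x : 'cV[R[i]]_2 :=
  \col_i if i == 0 then r%:C else (a / (2 * r)) +i* (b / (2 * r)).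
exists x; split.
  rewrite hdot2 !mxE /=; apply/eqP.
  rewrite eq_complex /=; apply/andP; split; apply/eqP; last by ring.
  transitivity (r ^+ 2 + (1 - r ^+ 2)); [rewrite -ab2|]; ring.
rewrite /bloch !mxE /=; congr (_, _, _) => /=; [by field|by field|].
transitivity (r ^+ 2 - (1 - r ^+ 2)); first by rewrite -ab2; ring.
by rewrite r2; field.
Qed.

(** * Numerical range, trace and determinant of a shifted Pauli combination *)

Lemma numerical_range_pauli (m p : R[i]) h k :
  numerical_range (m%:M + p *: pauli h k) =
  [set m + p * (dot h n +i* dot k n) | n in [set n | dot n n = 1]]%classic.
Proof.
have hdotE x : hdot x x = 1 -> hdot ((m%:M + p *: pauli h k) *m x) x =
    m + p * (dot h (bloch x) +i* dot k (bloch x)).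
  move=> x1; rewrite mulmxDl mul_scalar_mx -scalemxAl -hdot_pauli.
  transitivity (m * hdot x x + p * hdot (pauli h k *m x) x).
    by rewrite !hdot2 !mxE; ring.
  by rewrite x1 mulr1.
apply/seteqP; split=> [_ [x /= x1 <-]|_ [n /= n1 <-]].
  have {}x1 : hdot x x = 1 by rewrite -[LHS]sqrtCK -/(hnorm x) x1 expr1n.
  exists (bloch x); last by rewrite hdotE.
  by have := dot_bloch x; rewrite /= x1 expr1n => -[].
have [x [x1 <-]] := bloch_surj _ n1.
by exists x; rewrite ?hdotE //= /hnorm x1 sqrtC1.
Qed.

Lemma traceless_part_pauli (m p : R[i]) h k :
  traceless_part (m%:M + p *: pauli h k) = p *: pauli h k.
Proof.
rewrite /traceless_part mxtraceD mxtraceZ trace_pauli mulr0 addr0.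
have -> : \tr (m%:M : 'M_2) / 2 = m by rewrite mxtrace_scalar; field.
by rewrite addrC addKr.
Qed.

Lemma trace_shifted_pauli (m p : R[i]) h k :
  \tr (m%:M + p *: pauli h k) = m + m.
Proof.
by rewrite mxtraceD mxtraceZ trace_pauli mulr0 addr0 mxtrace_scalar mulr2n.
Qed.

(** The term linear in [m] is [m p] times the trace of [pauli h k], which vanishes. *)
Lemma det_shifted_pauli (m p : R[i]) h k :
  \det (m%:M + p *: pauli h k) = m ^+ 2 + p ^+ 2 * \det (pauli h k).
Proof.
rewrite !det_mx22 !(mxE, mulr0n, mulr1n) /=; ring.
Qed.

(** * Reduction of an arbitrary matrix by a choice of phase *)

Lemma phase_of (s : R[i]) : exists p, `|p| = 1 /\ s = p ^+ 2 * `|s|.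
Proof.
have [->|s0] := eqVneq s 0; first by exists 1; rewrite normr1 normr0 mulr0.
have t0 : sqrtC s != 0 by rewrite sqrtC_eq0.
have n0 : `|sqrtC s| != 0 by rewrite normr_eq0.
exists (sqrtC s / `|sqrtC s|); split.
  by rewrite normf_div normr_id divff.
have -> : `|s| = `|sqrtC s| ^+ 2 by rewrite -normrX sqrtCK.
by rewrite expr_div_n sqrtCK divfK // expf_neq0.
Qed.

Lemma shifted_pauli_form A : exists m p h k,
  [/\ `|p| = 1, dot h k = 0, dot k k <= dot h h & A = m%:M + p *: pauli h k].
Proof.
(* The Pauli coefficients of [A], that is, [w_j = tr (A sigma_j) / 2]. *)
pose w1 := (A 0 1 + A 1 0) / 2; pose w2 := 'i * (A 0 1 - A 1 0) / 2.
pose w3 := (A 0 0 - A 1 1) / 2.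
have [p [p1 sE]] := phase_of (w1 ^+ 2 + w2 ^+ 2 + w3 ^+ 2).
have pp : (p * p^* = 1)%R by rewrite -normCK p1 expr1n.
pose v (w : R[i]) := (p^* * w)%R.
have pv w : p * v w = w by rewrite /v mulrA pp mul1r.
pose h := (complex.Re (v w1), complex.Re (v w2), complex.Re (v w3)).
pose k := (complex.Im (v w1), complex.Im (v w2), complex.Im (v w3)).
have : 0 <= v w1 ^+ 2 + v w2 ^+ 2 + v w3 ^+ 2.
  have -> : v w1 ^+ 2 + v w2 ^+ 2 + v w3 ^+ 2 =
    (p^* ^+ 2 * (w1 ^+ 2 + w2 ^+ 2 + w3 ^+ 2))%R by rewrite /v; ring.
  by rewrite sE mulrA -exprMn [(p^* * p)%R]mulrC pp expr1n mul1r.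
have -> : v w1 ^+ 2 + v w2 ^+ 2 + v w3 ^+ 2 =
    (dot h h - dot k k) +i* (2 * dot h k).
  rewrite /h /k /dot; case: (v w1) (v w2) (v w3) => [? ?] [? ?] [? ?] /=.
  apply/eqP; rewrite eq_complex /=; apply/andP; split; apply/eqP; ring.
(* Nonnegativity in [R[i]] means zero imaginary part and nonnegative real part, so it yields both
   conditions on [h] and [k] at once. *)
rewrite lecE /= => /andP[/eqP hk kh].
exists ((A 0 0 + A 1 1) / 2), p, h, k; split => //; [by lra|by lra|].
clearbody v.
have i2 : 'i * 'i = -1 :> R[i] by rewrite -expr2 sqr_i.
have vE w : complex.Re (v w) +i* complex.Im (v w) = v w by case: (v w).
have ord2P (i : 'I_2) : i = 0 \/ i = 1.
  by case: i => [[|[|]]] // ?; [left|right]; exact: val_inj.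
apply/matrixP => i j; rewrite !mxE /= !vE.
have iw2 : 'i * w2 = - ((A 0 1 - A 1 0) / 2).
  by rewrite /w2 -mulrA mulrA i2 mulN1r.
case: (ord2P i) => ->; case: (ord2P j) => -> /=;
rewrite ?mulr0n ?mulr1n ?mulrN ?mulrDr ?mulrN ?(mulrCA p) !pv ?iw2 /w1 /w3.
- by field.
- by field.
- by field.
- by field.
Qed.

(** * Semi-axes, foci and the elliptical disk *)

(** Both trace terms are unaffected by the unimodular [p], and the absolute value opens because [k]
    is the shorter vector. The radicands [2 (|h|^2 + |k|^2) ± 2 (|h|^2 - |k|^2)] are then [4 |h|^2]
    and [4 |k|^2]. *)
Lemma semiaxes_pauli (m p : R[i]) h k : `|p| = 1 -> dot h k = 0 ->
  dot k k <= dot h h ->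
  semiaxis_plus (m%:M + p *: pauli h k) = len h /\
  semiaxis_minus (m%:M + p *: pauli h k) = len k.
Proof.
move=> p1 hk kh; rewrite /semiaxis_plus /semiaxis_minus.
rewrite /radicand_plus /radicand_minus traceless_part_pauli.
have -> : \tr (((p *: pauli h k)^t*)%sesqui *m (p *: pauli h k)) =
    (2 * (dot h h + dot k k))%:C.
  transitivity ((p * p^*)%R * \tr (((pauli h k)^t*)%sesqui *m pauli h k)).
    by move: (pauli h k) => T; rewrite !mxtrace22 !mulmx22 !mxE; ring.
  by rewrite -normCK p1 expr1n mul1r trace_pauli_adj.
have -> : `|\tr ((p *: pauli h k) *m (p *: pauli h k))| =
    (2 * (dot h h - dot k k))%:C.
  rewrite -scalemxAl -scalemxAr !mxtraceZ trace_pauli_sqr hk mulr0 !normrM p1.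
  rewrite !mul1r normr_nat (ger0_norm (x := _%:C)) ?ler0c ?subr_ge0//.
  by rewrite rmorphM rmorph_nat.
have sqrt4 a : 2^-1 * Num.sqrt (4 * dot a a) = len a.
  have -> : 4 * dot a a = 2 ^+ 2 * dot a a by ring.
  by rewrite sqrtrM ?sqr_ge0// sqrtr_sqr ger0_norm// mulKf ?pnatr_eq0.
rewrite -!sqrt4 /=; split; congr (_ * Num.sqrt _); ring.
Qed.

Lemma is_elliptical_disk_pauli (m p : R[i]) h k : `|p| = 1 -> dot h k = 0 ->
  dot k k <= dot h h -> let A := m%:M + p *: pauli h k in
  is_elliptical_disk (numerical_range A) (eigenvalues A) (len h) (len k).
Proof.
move=> p1 hk kh A; split.
  by rewrite /len sqrtr_ge0 /= ler_wsqrtr.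
have phiB z w : m + p * z - (m + p * w) = p * (z - w) by ring.
exists (fun z => m + p * z); split=> [z w|z0 z1 z2||].
- by rewrite phiB normrM p1 mul1r.
(* Multiplication by [p] scales signed areas by [|p|^2 = 1]. *)
- have -> // : signed_area (m + p * z0) (m + p * z1) (m + p * z2) =
    signed_area z0 z1 z2.
  rewrite /signed_area !phiB rmorphM mulrACA [(p^* * p)%R]mulrC -normCK p1.
  by rewrite expr1n mul1r.
- have [e [f [ef he kf]]] := exists_orthonormal_axes _ h k hk kh.
  rewrite /A numerical_range_pauli.
  have dotE n : dot h n +i* dot k n =
      (len h * dot e n) +i* (len k * dot f n).
    by rewrite -!dot_scalel -he -kf.
  apply/seteqP; split=> [_ [n /= n1 <-]|_ [_ [u [v [uv ->]]] <-]].
    exists (dot h n +i* dot k n) => //; exists (dot e n), (dot f n).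
    by rewrite dotE; split => //; apply/(sphere_projection _ _ _ _ _ ef); exists n.
  have [n [n1 <- <-]] := (sphere_projection _ _ _ _ _ ef).2 uv.
  by exists n; rewrite ?dotE.
(* The foci are [m + p c] and [m - p c]; they are the eigenvalues because the trace is [2 m] and the
   determinant is [m^2 - (p c)^2]. *)
move=> c; rewrite mulrN; apply: eigenvalues_mx22.
  exact: trace_shifted_pauli.
have c2 : c ^+ 2 = (dot h h - dot k k)%:C.
  by rewrite /c !len_sqr -rmorphXn /= sqr_sqrtr ?subr_ge0.
rewrite det_shifted_pauli det_pauli hk mulr0 oppr0 exprMn c2 -mulrN -rmorphN.
by rewrite opprB.
Qed.

End Pauli.

Theorem theorem1 (R : realType) (A : 'M[R[i]]_2) :
  is_elliptical_disk (numerical_range A) (eigenvalues A)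
    (semiaxis_plus A) (semiaxis_minus A).
Proof.
have [m [p [h [k [p1 hk kh ->]]]]] := shifted_pauli_form _ A.
have [-> ->] := semiaxes_pauli _ m _ _ _ p1 hk kh.
exact: is_elliptical_disk_pauli.
Qed.
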